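(* Let $F\in\mathcal{F}^*$. Then there is $\gamma_->0$ such that for all $N\in\mathbb{N}$ $$\mu_{\phi^+}\bigl(\{(\theta,x)\in\mathbb{T}^D\times[0,1]:\lambda_N(\theta,x)\ge0\}\bigr)\le e^{-\gamma_-N}.$$
   Context: $\mathbb{T}^D=\mathbb{R}^D/\mathbb{Z}^D$ ($D\ge1$), with metric $\operatorname{dist}$ induced by the Euclidean metric; $\mathbb{N}=\{1,2,\dots\}$. The class $\mathcal{F}$: maps $F:\mathbb{T}^D\times[0,1]\to\mathbb{T}^D\times[0,1]$, $F(\theta,x)=(\theta+\rho,F_\theta(x))$, where $\rho\in\mathbb{T}^D$ is a rotation vector such that $\theta\mapsto\theta+\rho$ is minimal, satisfying: (i) each fibre map $F_\theta:[0,1]\to[0,1]$ is non-decreasing; (ii) each $F_\theta$ is differentiable and $(\theta,x)\mapsto F_\theta'(x)$ is continuous on $\mathbb{T}^D\times[0,1]$; (iii) $F$ is pinched: there is $\theta_*\in\mathbb{T}^D$ with $F_{\theta_*}(x)=0$ for all $x\in[0,1]$; (iv) $F_\theta(0)=0$ for all $\theta\in\mathbb{T}^D$. The class $\mathcal{F}^*$: those $F\in\mathcal{F}$ for which there exist constants $\alpha>2$, $\beta>0$, $\gamma>0$, $L_0\in(0,1)$, $c>0$, $d>1$, $m\in\mathbb{N}$, $a>1$, $0<b<1$ such that, with $\tau_n=\theta_*+n\rho$, for all $\theta,\theta'\in\mathbb{T}^D$: 1. $|F_\theta(x)-F_\theta(y)|\le\alpha|x-y|$ for all $x,y\in[0,1]$;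 2. $|F_\theta(x)-F_\theta(y)|\le\alpha^{-\gamma}|x-y|$ for all $x,y\in[L_0,1]$; 3. $|F_\theta(x)-F_{\theta'}(x)|\le\beta\operatorname{dist}(\theta,\theta')$ for all $x\in[0,1]$; 4. $\operatorname{dist}(\tau_n,\theta_* )\ge c\cdot n^{-d}$ for all $n\in\mathbb{N}$; 5. $m>22(1+\frac1\gamma)$; 6. $a\ge(m+1)^d$; 7. $b\le c$; 8. $\operatorname{dist}(\tau_n,\theta_* )>b$ for all $n\in\{1,\dots,m-1\}$; 9. $F_\theta(x)\ge\min\{2L_0,ax\}\cdot\min\{1,\frac2b\operatorname{dist}(\theta,\theta_* )\}$ for all $x\in[0,1]$. Write $F^N_\theta(x)$ for the second coordinate of $F^N(\theta,x)$. The time-$N$ Lyapunov exponent is $\lambda_N(\theta,x)=\frac1N\log\bigl((F^N_\theta)'(x)\bigr)$ (with $\log0=-\infty$). The upper boundary graph of the global attractor is $\phi^+(\theta)=\sup\{x\in[0,1]:(\theta,x)\in\bigcap_{n\in\mathbb{N}}F^n(\mathbb{T}^D\times[0,1])\}$, and $\mu_{\phi^+}$ is the measure $\mu_{\phi^+}(A)=\operatorname{Leb}_{\mathbb{T}^D}(\{\theta\in\mathbb{T}^D:(\theta,\phi^+(\theta))\in A\})$ for measurable $A\subseteq\mathbb{T}^D\times[0,1]$. *)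

(* Defs.v *)
From HB Require Import structures.
From mathcomp Require Import all_boot all_order all_algebra.
From mathcomp Require Import archimedean generic_quotient ring_quotient.
From mathcomp Require Import all_classical all_reals all_analysis.
From mathcomp Require Import measurable_realfun.

Set Implicit Arguments.
Unset Strict Implicit.
Unset Printing Implicit Defensive.

Import Order.TTheory GRing.Theory Num.Theory.
Import numFieldNormedType.Exports.

Local Open Scope classical_set_scope.
Local Open Scope quotient_scope.
Local Open Scope ring_scope.

Section torus.
Variables (R : realType) (D : nat).

Definition lattice : {pred 'rV[R]_D} := fun v => v \is a mxOver Num.int.

Lemma lattice_zmod_closed : zmod_closed lattice.
Proof.
split=> [|u v /mxOverP uZ /mxOverP vZ]; first exact/mxOver_const/rpred0.
by apply/mxOverP => i j; rewrite !mxE rpredB.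
Qed.

HB.instance Definition _ :=
  GRing.isZmodClosed.Build 'rV[R]_D lattice lattice_zmod_closed.

Definition torus : Type := quotient_topology (Quotient.quot lattice).

HB.instance Definition _ := Topological.on torus.
HB.instance Definition _ := generic_quotient.Quotient.on torus.
HB.instance Definition _ := @GRing.isZmodule.Build torus _ _ _
  (@Quotient.addqA _ lattice) (@Quotient.addqC _ lattice)
  (@Quotient.add0q _ lattice) (@Quotient.addNq _ lattice).

Lemma pi_torusD : {morph \pi_torus : u v / u + v}.
Proof. exact: (@Quotient.pi_add _ lattice). Qed.

HB.instance Definition _ := isPointed.Build torus 0.

(* Quotient metric of the Euclidean norm; the norm mathcomp-analysis puts on
   'rV[R]_D is the sup norm, hence the explicit Euclidean one. *)
Definition enorm (v : 'rV[R]_D) : R := Num.sqrt (\sum_i v 0 i ^+ 2).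

Definition tdist (s t : torus) : R :=
  inf [set enorm (u - v) | u in \pi_torus @^-1` [set s]
                         & v in \pi_torus @^-1` [set t]].

Definition borel_torus : Type := g_sigma_algebraType (@open torus).
HB.instance Definition _ := Measurable.on borel_torus.

Definition torus_of_tuple (t : D.-tuple (measurableTypeR R)) : borel_torus :=
  \pi_torus (\row_i (tnth t i : R)).

Lemma open_row_measurable (V : set 'rV[R]_D) : open V ->
  measurable [set t : D.-tuple (measurableTypeR R) | V (\row_i (tnth t i : R))].
Proof.
move=> oV.
pose box (q : 'rV[rat]_D * nat) : set 'rV[R]_D :=
  [set v | forall i, `|ratr (q.1 0 i) - v 0 i| < q.2.+1%:R^-1].
pose B q : set (D.-tuple (measurableTypeR R)) :=
  [set t | box q `<=` V /\ box q (\row_i (tnth t i : R))].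
have -> : [set t : D.-tuple (measurableTypeR R) | V (\row_i (tnth t i : R))]
    = \bigcup_q B q.
  apply/seteqP; split=> [t /= Vt|t /= [q _ [sV]]]; last exact: sV.
  set v := (\row_i (tnth t i : R)) in Vt *.
  have /nbhs_ballP[e /= e0 eV] : nbhs v V by exact: open_nbhs_nbhs.
  pose n := Num.truncn (e / 2)^-1.
  have n2 : n.+1%:R^-1 < e / 2.
    rewrite invf_plt ?posrE ?divr_gt0 ?ltr0n//.
    by rewrite truncnS_gt.
  have ratP i : exists r : rat, `|ratr r - v 0 i| < n.+1%:R^-1.
    have : v 0 i - n.+1%:R^-1 < v 0 i + n.+1%:R^-1.
      by rewrite ltrD2l gtrN// invr_gt0 ltr0n.
    move=> /rat_in_itvoo[r]; rewrite in_itv/= => /andP[r1 r2]; exists r.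
    by rewrite ltr_distlC ltrBlDr; apply/andP; split=> //; rewrite ltrBlDr in r1.
  have [r rP] := choice ratP.
  exists (\row_i r i, n) => //; split=> [w /= wb|i /=]; last by rewrite mxE.
  apply: eV; split=> // a i; rewrite [a]ord1 /ball/=.
  have := wb i; have := rP i; rewrite [(\row_j r j) 0 i]mxE => h1 h2.
  apply: le_lt_trans (ler_distD (ratr (r i)) _ _) _; rewrite distrC (splitr e).
  by apply: ltrD; apply: lt_trans n2.
apply: countable_bigcupT_measurable => // q.
have [sV|nV] := pselect (box q `<=` V); last first.
  by rewrite (_ : B q = set0)//; apply/seteqP; split=> t // [].
have -> : B q = \bigcap_(i in [set: 'I_D])
    ((@tnth D (measurableTypeR R) ^~ i) @^-1` (ball (ratr (q.1 0 i) : R) q.2.+1%:R^-1)).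
  apply/seteqP; split=> t /= => [[_ bt] i _ |bt].
    by have := bt i; rewrite mxE.
  by split=> // i; have := bt i Logic.I; rewrite /ball/= mxE.
apply: fin_bigcap_measurable => // i _; rewrite -[X in measurable X]setTI.
apply: measurable_tnth => //; exact: measurable_ball.
Qed.

Lemma measurable_torus_of_tuple : measurable_fun setT torus_of_tuple.
Proof.
apply (@measurability _ _ _ borel_torus setT torus_of_tuple (@open torus)).
  by [].
move=> _ [A oA <-]; rewrite setTI.
exact: (@open_row_measurable (\pi_torus @^-1` A)).
Qed.

HB.instance Definition _ := isMeasurableFun.Build _ _ _ _ torus_of_tuple
  measurable_torus_of_tuple.

End torus.

Section lebesgue.
Variable R : realType.

Definition tuple_cons n (p : measurableTypeR R * n.-tuple (measurableTypeR R)) :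
  n.+1.-tuple (measurableTypeR R) := [tuple of p.1 :: p.2].

Lemma measurable_tuple_cons n : measurable_fun setT (@tuple_cons n).
Proof. exact: measurable_cons. Qed.

HB.instance Definition _ n := isMeasurableFun.Build _ _ _ _ (@tuple_cons n)
  (@measurable_tuple_cons n).

(* n-fold product of Lebesgue measure on [0, 1] (the uniform probability);
   its image under the quotient map is Lebesgue measure on the torus. *)
Fixpoint lebesgue_cube n : probability (n.-tuple (measurableTypeR R)) R :=
  if n is n'.+1 then
    distribution (uniform_prob (@ltr01 R) \x lebesgue_cube n')%E (@tuple_cons n')
  else \d_ [tuple of [::]].

Definition lebesgue_torus D : probability (borel_torus R D) R :=
  distribution (lebesgue_cube D) (@torus_of_tuple R D).
End lebesgue.

Section skew_product.
Variables (R : realType) (D : nat).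
Implicit Types (F : torus R D * R -> torus R D * R) (f : R -> R) (t : torus R D).

Local Notation I01 := (`[0, 1]%classic : set R).

Definition phase : set (torus R D * R) := [set: torus R D] `*` I01.

Definition fibre F t : R -> R := fun x => (F (t, x)).2.

(* Derivative of f : [0, 1] -> R, one-sided at the end points: the values of f
   outside [0, 1] are irrelevant. *)
Definition quotient01 f (x : R) : R -> R := fun y => (f y - f x) / (y - x).

Definition derivable01 f (x : R) : Prop :=
  cvg (quotient01 f x y @[y --> within I01 x^']).

Definition derive01 f (x : R) : R :=
  lim (quotient01 f x y @[y --> within I01 x^']).

Definition minimal_rotation (rho : torus R D) : Prop :=
  forall t, dense [set t + rho *+ n | n in [set: nat]].

(* F is a total function, but only its restriction to the phase space matters.
   The rotation vector rho and the pinched point tstar are parameters, as the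
   further conditions defining class_Fstar refer to them. *)
Record class_F_at F (rho tstar : torus R D) : Prop := {
  rotation_minimal : minimal_rotation rho ;
  skew_rotation : forall t (x : R), I01 x -> (F (t, x)).1 = t + rho ;
  fibre_unit : forall t (x : R), I01 x -> I01 (fibre F t x) ;
  fibre_nondecreasing : forall t,
    {in I01 &, {homo fibre F t : x y / x <= y}} ;
  fibre_derivable : forall t (x : R), I01 x -> derivable01 (fibre F t) x ;
  fibre_derive_continuous :
    {within phase, continuous (fun p => derive01 (fibre F p.1) p.2)} ;
  pinched : forall x : R, I01 x -> fibre F tstar x = 0 ;
  zero_line : forall t, fibre F t 0 = 0
}.

Record star_conditions F (rho tstar : torus R D)
    (alpha beta gamma L0 c d : R) (m : nat) (a b : R) : Prop := {
  alpha_gt2 : 2 < alpha ;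
  beta_gt0 : 0 < beta ;
  gamma_gt0 : 0 < gamma ;
  L0_unit : 0 < L0 < 1 ;
  c_gt0 : 0 < c ;
  d_gt1 : 1 < d ;
  m_gt0 : (0 < m)%N ;
  a_gt1 : 1 < a ;
  b_unit : 0 < b < 1 ;
  star1 : forall t (x y : R), I01 x -> I01 y ->
    `|fibre F t x - fibre F t y| <= alpha * `|x - y| ;
  star2 : forall t (x y : R), L0 <= x <= 1 -> L0 <= y <= 1 ->
    `|fibre F t x - fibre F t y| <= alpha `^ (- gamma) * `|x - y| ;
  star3 : forall t t' (x : R), I01 x ->
    `|fibre F t x - fibre F t' x| <= beta * tdist t t' ;
  star4 : forall n, (0 < n)%N ->
    c * n%:R `^ (- d) <= tdist (tstar + rho *+ n) tstar ;
  star5 : 22%:R * (1 + 1 / gamma) < m%:R ;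
  star6 : m.+1%:R `^ d <= a ;
  star7 : b <= c ;
  star8 : forall n, (1 <= n <= m.-1)%N -> b < tdist (tstar + rho *+ n) tstar ;
  star9 : forall t (x : R), I01 x ->
    Num.min (2 * L0) (a * x) * Num.min 1 (2 / b * tdist t tstar)
      <= fibre F t x
}.

Definition class_Fstar F : Prop := exists rho tstar,
  class_F_at F rho tstar /\
  exists (alpha beta gamma L0 c d : R) (m : nat) (a b : R),
    star_conditions F rho tstar alpha beta gamma L0 c d m a b.

(* lne 0 = -oo *)
Definition lyapunov F (N : nat) (p : torus R D * R) : \bar R :=
  ((N%:R^-1)%:E * lne (derive01 (fibre (iter N F) p.1) p.2)%:E)%E.

Definition global_attractor F : set (torus R D * R) :=
  \bigcap_(n in [set n | (0 < n)%N]) (iter n F @` phase).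

Definition phi_plus F t : R :=
  sup [set x | I01 x /\ global_attractor F (t, x)].

Definition mu_phi_plus F : set (torus R D * R) -> \bar R :=
  fun A => lebesgue_torus R D [set t : torus R D | A (t, phi_plus F t)].

End skew_product.

(* Main.v *)
(** Measure the depth of a fibre value [x] by the least [z] with
    [2 L0 a^-z <= x].  By condition 9 a step of [F] lowers the depth by one
    (down to zero), except that a visit to the ball of radius [(b/2) a^-(j-1)]
    around the pinched point adds at least [j] to it: the depth is bounded by the
    workload of a queue.  The Diophantine conditions 4 to 8 make visits to the
    [j]-th ball so rare that during any [n] steps the total input is at most
    [4n/m] plus the deepest single visit.  Hence, unless the orbit of [theta] visits
    an exponentially small ball during [N] steps, or the backward orbit visits balls
    shrinking exponentially with time (which is what makes [phi_plus theta] small),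
    fewer than [gamma N / (1 + gamma)] of the first [N] iterates lie below
    [L0], and conditions 1 and 2 make the derivative of the [N]-th iterate less than
    one.  The exceptional set is a union of balls of exponentially small total
    measure.  For the finitely many remaining [N] it suffices that the exceptional set
    misses a neighbourhood of the pinched point, where the derivative is small
    uniformly in [x]. *)
Require Import Defs.
From mathcomp Require Import all_boot all_order all_algebra.
From mathcomp Require Import archimedean generic_quotient ring_quotient.
From mathcomp Require Import all_classical all_reals all_analysis.
From mathcomp Require Import measurable_realfun.
From mathcomp Require Import ring lra zify.

Set Implicit Arguments.
Unset Strict Implicit.
Unset Printing Implicit Defensive.

Import Order.TTheory GRing.Theory Num.Theory.
Import numFieldNormedType.Exports.

Local Open Scope classical_set_scope.
Local Open Scope quotient_scope.
Local Open Scope ring_scope.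

(** * Lebesgue measure of subsets of the cube *)

(* The integral of a nonnegative function is a supremum over simple functions, so
   it is monotone without measurability; hence so is [lebesgue_cube], and the
   measurability of [phi_plus] is never needed. *)
Lemma integral_homo_nonmeasurable d (T : measurableType d) (R : realType)
    (mu : {measure set T -> \bar R}) (f g : T -> \bar R) :
  (forall x, 0 <= f x)%E -> (forall x, f x <= g x)%E ->
  (\int[mu]_x f x <= \int[mu]_x g x)%E.
Proof.
move=> f0 fg.
have g0 x : (0 <= g x)%E by exact: le_trans (f0 x) (fg x).
rewrite !ge0_integralTE//; apply: le_ereal_sup => _ [h hf <-].
by exists h => // x; exact: le_trans (hf x) (fg x).
Qed.

Lemma lebesgue_cube_homo (R : realType) n
    (A B : set (n.-tuple (measurableTypeR R))) : A `<=` B ->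
  (lebesgue_cube R n A <= lebesgue_cube R n B)%E.
Proof.
elim: n A B => [A B AB /=|n IH A B AB]; rewrite /=.
  rewrite !diracE lee_fin ler_nat.
  have [/set_mem/AB/mem_set->//|] := boolP (_ \in A).
  by [].
rewrite /distribution /pushforward /product_measure1.
apply: integral_homo_nonmeasurable => x /=; first exact: measure_ge0.
by apply: IH => y; rewrite /xsection /= !inE; exact: AB.
Qed.

(** The exceptional set will be enclosed in a set that constrains the first coordinate only, so that
    its measure becomes one-dimensional. *)
Lemma lebesgue_cube_thead (R : realType) n (S : set R) : measurable S ->
  lebesgue_cube R n.+1 [set p | S (thead p)] = uniform_prob (@ltr01 R) S.
Proof.
move=> mS; rewrite /= /distribution /pushforward.
rewrite (_ : _ @^-1` _ = S `*` setT); last first.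
  by apply/seteqP; split=> -[x y]; rewrite /= theadE => //; case.
by rewrite product_measure1E// [X in (_ * X)%E]probability_setT mule1.
Qed.

Lemma uniform_prob01E (R : realType) (S : set R) : measurable S ->
  uniform_prob (@ltr01 R) S = lebesgue_measure (S `&` `[0%R, 1%R]%classic).
Proof.
move=> mS; rewrite /uniform_prob integral_uniform_pdf.
under eq_integral => x.
  rewrite inE /= in_itv /= => -[_ x01].
  rewrite /uniform_pdf x01 subr0 invr1; over.
by rewrite integral_cst ?mul1e//; exact: measurableI.
Qed.

Lemma uniform_prob_itvoo (R : realType) (x y : R) : 0 <= x -> x <= y -> y <= 1 ->
  uniform_prob (@ltr01 R) `]x, y[%classic = (y - x)%:E.
Proof.
move=> x0 xy y1; rewrite uniform_prob01E// setIidl.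
  rewrite lebesgue_measure_itv /= lte_fin; case: ltgtP xy => // ->.
  by rewrite subrr.
move=> z /=; rewrite !in_itv /= => /andP[xz zy].
by rewrite (le_trans x0 (ltW xz)) (le_trans (ltW zy) y1).
Qed.

Lemma measurable_tuple_box (R : realType) n (v : 'I_n -> R) (s : R) :
  measurable ([set p | forall i, (v i < tnth p i < v i + s)%R]
    : set (n.-tuple (measurableTypeR R))).
Proof.
rewrite (_ : [set p | _] = \bigcap_(i in [set: 'I_n])
    ((@tnth n (measurableTypeR R) ^~ i) @^-1` `]v i, v i + s[%classic)).
  apply: fin_bigcap_measurable => // i _; rewrite -[X in measurable X]setTI.
  by apply: measurable_tnth => //; exact: measurable_itv.
apply/seteqP; split=> p /= H i; first by move=> _ /=; rewrite in_itv; exact: H.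
by have := H i Logic.I; rewrite /= in_itv.
Qed.

Lemma lebesgue_cube_box_gt0 (R : realType) n (v : 'I_n -> R) (s : R) :
  0 < s -> (forall i, 0 <= v i < 1) ->
  (0 < lebesgue_cube R n [set p | forall i, (v i < tnth p i < v i + s)%R])%E.
Proof.
move=> s0; elim: n v => [v _ /=|n IH v v01].
  by rewrite diracE mem_set// => -[].
have /andP[v0 v1] := v01 ord0.
(* The side may stick out of the unit interval; cutting it at 1 leaves positive length because
   [v ord0 < 1]. *)
pose t := Num.min (v ord0 + s) 1.
pose B := [set p : n.-tuple (measurableTypeR R) |
  forall i, (v (lift ord0 i) < tnth p i < v (lift ord0 i) + s)%R].
have mB : measurable B by exact: measurable_tuple_box.
have vt : v ord0 < t by rewrite lt_min v1 ltrDl s0.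
pose A := @tuple_cons R n @` (`]v ord0, t[%classic `*` B).
apply: lt_le_trans (lebesgue_cube_homo (A := A) _); last first.
  move=> _ [[x p] /= [xv Bp] <-] i.
  move: xv; rewrite /= in_itv /= lt_min => /andP[vx /andP[xs x1]].
  case: (unliftP ord0 i) => [j|] ->; first by rewrite tnthS; exact: Bp.
  by rewrite tnth0 vx xs.
rewrite /= /distribution /pushforward.
rewrite (_ : _ @^-1` _ = `]v ord0, t[%classic `*` B); last first.
  apply/seteqP; split=> [[x p] [[y q] yq /(congr1 val)[<- qp]]|].
    by rewrite -(val_inj qp).
  by move=> [x p] ?; exists (x, p).
rewrite product_measure1E//.
apply: mule_gt0; last by apply: IH => i; exact: v01.
have t1 : t <= 1 by rewrite ge_min lexx orbT.
by rewrite [ltRHS](uniform_prob_itvoo v0 (ltW vt) t1) lte_fin subr_gt0.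
Qed.

(** The open arc of radius [r] around [v] in R/Z, pulled back to the line. *)
Definition circle_ball (R : realType) (v r : R) : set R :=
  [set x | exists k : int, `|x - v - k%:~R| < r].

Lemma open_circle_ball (R : realType) (v r : R) : open (circle_ball v r).
Proof.
rewrite (_ : circle_ball v r = \bigcup_(k : int) ball (v + k%:~R) r).
  by apply: bigcup_open => k _; exact: ball_open.
apply/seteqP; split=> x [k].
  by move=> kr; exists k => //; rewrite /ball /= distrC opprD addrA.
by move=> _; rewrite /ball /= distrC opprD addrA => kr; exists k.
Qed.

Lemma measurable_circle_ball (R : realType) (v r : R) :
  measurable (circle_ball v r).
Proof. by apply: open_measurable; exact: open_circle_ball. Qed.

(** Once the centre is reduced to [0, 1), only its translates by -1, 0 and 1 come within [r <= 1] of
    the unit interval; each contributes an interval of length [2 * r]. *)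
Lemma uniform_prob_circle_ball (R : realType) (v r : R) : 0 <= r <= 1 ->
  (uniform_prob (@ltr01 R) (circle_ball v r) <= (6 * r)%:E)%E.
Proof.
move=> /andP[r0 r1]; have mS := measurable_circle_ball v r.
rewrite uniform_prob01E//.
pose w := v - (Num.floor v)%:~R.
have /andP[fv1 fv2] := floor_itv v.
have w0 : 0 <= w by rewrite subr_ge0.
have w1 : w < 1.
  by rewrite ltrBlDr addrC -[1]/(1%:~R) -intrD.
pose I c : set R := ball (w + c) r.
have mI c : measurable (I c) by exact: measurable_ball.
have lI c : lebesgue_measure (I c) = (2 * r)%:E.
  by rewrite lebesgue_measure_ball// mulr_natl.
apply: (@le_trans _ _ (lebesgue_measure (I (-1) `|` I 0 `|` I 1))).
  apply: le_measure; rewrite ?inE; first exact: measurableI.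
    exact: measurableU (measurableU _ _ (mI _) (mI _)) (mI _).
  move=> x [[k kr]]; rewrite /= in_itv /= => /andP[x0 x1].
  pose j := k + Num.floor v.
  have jr : `|x - w - j%:~R| < r.
    by have -> : x - w - j%:~R = x - v - k%:~R by rewrite /j /w intrD; ring.
  have Ij c : c = j%:~R -> I c x.
    by move=> ->; rewrite /I /ball /= distrC opprD addrA.
  have [jn1|j0|jp1] : [\/ j = -1, j = 0 | j = 1].
    have [j1 j2] : (-2)%:~R < j%:~R :> R /\ j%:~R < 2%:~R :> R.
      by move: jr; rewrite ltr_norml => /andP[]; split; lra.
    move: j1 j2; rewrite !ltr_int => j1 j2.
    have [->|[->|->]] : j = -1 \/ j = 0 \/ j = 1 by lia.
    - exact: Or31.
    - exact: Or32.
    - exact: Or33.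
  - by left; left; apply: Ij; rewrite jn1.
  - by left; right; apply: Ij; rewrite j0.
  - by right; apply: Ij; rewrite jp1.
apply: (@le_trans _ _ (lebesgue_measure (I (-1)%R) + lebesgue_measure (I 0%R)
    + lebesgue_measure (I 1%R))%E).
  apply: le_trans (measureU2 _ _ _) _ ; [exact: measurableU (mI _) (mI _)|exact: mI|].
  by apply: leeD => //; apply: measureU2; exact: mI.
by rewrite !lI -!EFinD lee_fin; lra.
Qed.

Lemma uniform_prob_bigcup_circle_ball (R : realType) (v r : nat -> R) (C : R) :
  (forall i, 0 <= r i <= 1) -> (forall n, \sum_(0 <= i < n) 6 * r i <= C) ->
  (uniform_prob (@ltr01 R) (\bigcup_i circle_ball (v i) (r i)) <= C%:E)%E.
Proof.
move=> r01 rC.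
have mS i : measurable (circle_ball (v i) (r i)) by exact: measurable_circle_ball.
have := measure_sigma_subadditive (uniform_prob (@ltr01 R)) mS
  (bigcupT_measurable _ mS) (@subset_refl _ _).
move=> /le_trans; apply; apply: lime_le.
  by apply: is_cvg_nneseries => i _ _; exact: measure_ge0.
apply: nearW => n; apply: (@le_trans _ _ (\sum_(0 <= i < n) (6 * r i)%:E)%E).
  by apply: lee_sum => i _; exact: uniform_prob_circle_ball.
by rewrite sumEFin lee_fin.
Qed.

(** * The torus metric *)

Section euclidean_norm.
Variables (R : realType) (D : nat).
Implicit Types u v : 'rV[R]_D.

Lemma enorm_ge0 u : 0 <= enorm u.
Proof. exact: sqrtr_ge0. Qed.

Lemma enorm_sq u : enorm u ^+ 2 = \sum_i u 0 i ^+ 2.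
Proof. by rewrite sqr_sqrtr// sumr_ge0// => i _; exact: sqr_ge0. Qed.

Lemma enormN u : enorm (- u) = enorm u.
Proof. by congr Num.sqrt; apply: eq_bigr => i _; rewrite mxE sqrrN. Qed.

Lemma ler_coord_enorm u i : `|u 0 i| <= enorm u.
Proof.
rewrite -(@ler_pXn2r _ 2)// ?nnegrE ?enorm_ge0// enorm_sq real_normK ?num_real//.
by rewrite (bigD1 i)//= lerDl sumr_ge0// => j _; exact: sqr_ge0.
Qed.

Lemma enorm_eq0 u : enorm u = 0 -> u = 0.
Proof.
move=> u0; apply/rowP => i; rewrite mxE.
by have := ler_coord_enorm u i; rewrite u0 normr_le0 => /eqP.
Qed.

(** Cauchy-Schwarz, by expanding the sum of the squares of [u 0 i * enorm v - v 0 i * enorm u]. *)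
Lemma dot_le_enorm u v : \sum_i u 0 i * v 0 i <= enorm u * enorm v.
Proof.
have [u0|u0] := eqVneq (enorm u) 0.
  by rewrite u0 mul0r (enorm_eq0 u0) big1// => i _; rewrite mxE mul0r.
have [v0|v0] := eqVneq (enorm v) 0.
  by rewrite v0 mulr0 (enorm_eq0 v0) big1// => i _; rewrite mxE mulr0.
have uv0 : 0 < enorm u * enorm v by rewrite mulr_gt0// lt_neqAle eq_sym ?u0 ?v0 enorm_ge0.
have : 0 <= \sum_i (u 0 i * enorm v - v 0 i * enorm u) ^+ 2.
  by rewrite sumr_ge0// => i _; exact: sqr_ge0.
under eq_bigr => i _.
  rewrite (_ : _ ^+ 2 = u 0 i ^+ 2 * enorm v ^+ 2 + v 0 i ^+ 2 * enorm u ^+ 2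
    - (u 0 i * v 0 i) * (2 * (enorm u * enorm v))); last by ring.
  over.
rewrite sumrB big_split /= -!mulr_suml -!enorm_sq => H.
rewrite -(ler_pM2r uv0); lra.
Qed.

Lemma ler_enormD u v : enorm (u + v) <= enorm u + enorm v.
Proof.
rewrite -(@ler_pXn2r _ 2)// ?nnegrE ?addr_ge0 ?enorm_ge0//.
rewrite sqrrD !enorm_sq.
under eq_bigr => i _ do rewrite mxE sqrrD.
rewrite !big_split /= lerD2r lerD2l mulr2n.
by rewrite lerD ?dot_le_enorm.
Qed.

End euclidean_norm.

Section torus_metric.
Variables (R : realType) (D : nat).
Implicit Types (u v w : 'rV[R]_D) (s t : torus R D).

Lemma pi_torus0 : \pi_(torus R D) (0 : 'rV[R]_D) = 0.
Proof.
by apply: (@addIr _ (\pi_(torus R D) (0 : 'rV[R]_D))); rewrite -pi_torusD !add0r.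
Qed.

Lemma pi_torusN : {morph \pi_(torus R D) : u / - u}.
Proof.
move=> u; apply: (@addIr _ (\pi_(torus R D) u)).
by rewrite -pi_torusD !addNr pi_torus0.
Qed.

Lemma pi_torusB : {morph \pi_(torus R D) : u v / u - v}.
Proof. by move=> u v; rewrite pi_torusD pi_torusN. Qed.

Lemma pi_torus_eq0 u : \pi_(torus R D) u = 0 <-> u \is a mxOver Num.int.
Proof.
rewrite -[u in X in _ <-> X]subr0 -[_ \is a _]/((u - 0) \in @lattice R D).
rewrite (@Quotient.idealrBE _ (@lattice R D)) -pi_torus0.
split=> [H|/eqP //]; exact/eqP.
Qed.

Lemma torus_lift01 t : exists2 v, \pi_(torus R D) v = t &
  forall i, 0 <= v 0 i < 1.
Proof.
pose u : 'rV[R]_D := repr t.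
exists (u - \row_i (Num.floor (u 0 i))%:~R).
  rewrite pi_torusB [X in _ - X](_ : _ = 0) ?subr0 ?reprK//.
  by apply/pi_torus_eq0; apply/mxOverP => i j; rewrite mxE.
move=> i; rewrite !mxE; have := floor_itv (u 0 i); rewrite intrD.
by move=> /andP[? ?]; apply/andP; split; lra.
Qed.

(** Together with [tdist_lt_lift] this trades the infimum over pairs of lifts for one over lifts of
    the difference [s - t], which makes the metric axioms and translation invariance immediate. *)
Lemma tdist_le_enorm s t w : \pi_(torus R D) w = s - t -> tdist s t <= enorm w.
Proof.
move=> ws; apply: ge_inf.
  by exists 0 => _ [u _ [v _ <-]]; exact: enorm_ge0.
exists (w + repr t) => /=; first by rewrite pi_torusD ws reprK subrK.
by exists (repr t); [exact: reprK|rewrite addrK].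
Qed.

Lemma tdist_lt_lift s t (r : R) : tdist s t < r ->
  exists2 w, \pi_(torus R D) w = s - t & enorm w < r.
Proof.
have tn0 : [set enorm (u - v) | u in \pi_(torus R D) @^-1` [set s]
                         & v in \pi_(torus R D) @^-1` [set t]] !=set0.
  by exists (enorm (repr s - repr t)); exists (repr s); rewrite /= ?reprK//;
     exists (repr t); rewrite /= ?reprK.
move=> /(inf_lt tn0)[_ [u /= us [v /= vt <-]] uv].
by exists (u - v) => //; rewrite pi_torusB us vt.
Qed.

Lemma tdist_triangle t s (x : torus R D) : tdist s x <= tdist s t + tdist t x.
Proof.
apply/ler_addgt0Pl => e e0.
have [w1 w1E w1n] : exists2 w, \pi_(torus R D) w = s - t & enorm w < tdist s t + e / 2.
  by apply: tdist_lt_lift; rewrite ltrDl divr_gt0.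
have [w2 w2E w2n] : exists2 w, \pi_(torus R D) w = t - x & enorm w < tdist t x + e / 2.
  by apply: tdist_lt_lift; rewrite ltrDl divr_gt0.
apply: le_trans (tdist_le_enorm (w := w1 + w2) _) _.
  by rewrite pi_torusD w1E w2E addrA subrK.
apply: le_trans (ler_enormD _ _) _; lra.
Qed.

Lemma tdistC s t : tdist s t = tdist t s.
Proof.
suff H : forall a b : torus R D, tdist a b <= tdist b a by apply: le_anti; rewrite !H.
move=> a b; apply/ler_addgt0Pl => e e0.
have [w wE wn] : exists2 w, \pi_(torus R D) w = b - a & enorm w < e + tdist b a.
  by apply: tdist_lt_lift; rewrite ltrDr.
apply: le_trans (ltW wn); rewrite -enormN; apply: tdist_le_enorm.
by rewrite pi_torusN wE opprB.
Qed.

Lemma tdistD2r (x s t : torus R D) : tdist (s + x) (t + x) = tdist s t.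
Proof.
have H (a b c : torus R D) : tdist (a + c) (b + c) <= tdist a b.
  apply/ler_addgt0Pl => e e0.
  have [w wE wn] : exists2 w, \pi_(torus R D) w = a - b & enorm w < e + tdist a b.
    by apply: tdist_lt_lift; rewrite ltrDr.
  apply: le_trans (ltW wn); apply: tdist_le_enorm.
  by rewrite wE opprD addrACA subrr addr0.
by apply: le_anti; rewrite H /= -{1}(addrK x s) -{1}(addrK x t) H.
Qed.

End torus_metric.

(** A coordinate is at most the Euclidean norm, so a ball projects into an arc of the same radius.
    The resulting measure bound, linear in the radius, is weaker than the volume of the ball but
    still decays exponentially. *)
Lemma tdist_circle_ball (R : realType) D (s t : torus R D.+1) :
  exists v, forall r (p : D.+1.-tuple (measurableTypeR R)),
    tdist ((torus_of_tuple p : torus R D.+1) + s) t < r -> circle_ball v r (thead p).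
Proof.
exists ((repr (t - s) : 'rV[R]_D.+1) 0 ord0) => r p /tdist_lt_lift[w wE wr].
set v : 'rV[R]_D.+1 := repr (t - s).
set q : 'rV[R]_D.+1 := \row_i (tnth p i : R).
have /pi_torus_eq0 : \pi_(torus R D.+1) (q - v - w) = 0.
  rewrite !pi_torusB wE reprK /torus_of_tuple -/q.
  by rewrite [_ - (t - s)](_ : _ = \pi_(torus R D.+1) q + s - t) ?subrr// opprB addrA.
move=> /mxOverP /(_ 0 ord0).
rewrite !mxE => /intrP[k kE]; exists k.
have -> : thead p - v 0 ord0 - k%:~R = w 0 ord0 by rewrite -kE /thead; ring.
exact: le_lt_trans (ler_coord_enorm _ _) wr.
Qed.

Lemma torus_nbhs_box (R : realType) D (t : torus R D) (U : set (torus R D)) :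
  nbhs t U -> exists (v : 'I_D -> R) (s : R), [/\ 0 < s,
    forall i, 0 <= v i < 1 &
    [set p : D.-tuple (measurableTypeR R) | forall i, v i < tnth p i < v i + s]
      `<=` @torus_of_tuple R D @^-1` U].
Proof.
rewrite nbhsE => -[V [oV Vt] VU].
have [v vt v01] := torus_lift01 t.
have oP : open (\pi_(torus R D) @^-1` V : set 'rV[R]_D) by exact: oV.
have /nbhs_ballP[e /= e0 eP] : nbhs v (\pi_(torus R D) @^-1` V).
  by apply: open_nbhs_nbhs; split=> //=; rewrite vt.
exists (fun i => v 0 i), e; split=> // p pb; apply: VU; apply: eP.
split=> // i j; rewrite !mxE /ball /= ord1.
by have /andP[] := pb j; rewrite ltr_distl; lra.
Qed.

(** * Rare visits and queues *)

Section rare_visits.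
Local Open Scope nat_scope.

(** Successive visits are at least [g / 2] apart, so all visits but one are paid for by elapsed
    time. *)
Lemma visit_count (P : pred nat) g N :
  (forall i k, i < k -> P i -> P k -> g <= 2 * (k - i)) ->
  g * (\sum_(k < N) P k) <= g + 2 * N.
Proof.
move=> gap.
(* Before a time [M] that is itself a visit, every visit is paid for by the gap to the next one, so
   no extra [g] appears. *)
have H M n : n <= M -> P M -> g * (\sum_(k < n) P k) <= 2 * M.
  elim: n M => [|n IH] M nM PM; first by rewrite big_ord0 muln0.
  rewrite big_ord_recr /=; case: (boolP (P n)) => Pn; last by rewrite addn0 IH// ltnW.
  rewrite mulnDr muln1.
  have := IH n (leqnn n) Pn; have := gap _ _ nM Pn PM.
  by move: (g * _) => a; lia.
elim: N => [|N IH]; first by rewrite big_ord0 muln0.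
rewrite big_ord_recr /= mulnDr; have := H N N (leqnn N); move: IH; move: (g * _) => a.
by case: (P N) => /= IH; [move=> /(_ isT)|]; lia.
Qed.

(* [G k] counts the nested balls around the pinched point entered at time [k];
   two entries of the [j]-th ball, [j < G k], are at least [m 2^j / 2] apart. *)
Definition sparse_levels (m : nat) (G : nat -> nat) :=
  forall j i k, i < k -> j < G i -> j < G k -> m * 2 ^ j <= 2 * (k - i).

(** By [visit_count], level [j] is entered at most 1 + 2N/(m 2^j) times; the sum over [j < J] is at
    most J + 4N/m. *)
Lemma sum_levels m G N J : sparse_levels m G ->
  (forall k, k < N -> G k <= J) ->
  m * (\sum_(k < N) G k) <= m * J + 4 * N.
Proof.
move=> sG GJ.
have -> : \sum_(k < N) G k = \sum_(j < J) \sum_(k < N) (j < G k).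
  rewrite exchange_big /=; apply: eq_bigr => k _.
  have GkJ := GJ k (ltn_ord k).
  rewrite -(big_mkord xpredT (fun j => (j < G k : nat))) (big_cat_nat (leq0n _) GkJ)//=.
  rewrite big_nat_cond [X in X + _](eq_bigr (fun=> 1)); last first.
    by move=> j /andP[/andP[_ ->]].
  rewrite -big_nat_cond sum_nat_const_nat muln1 subn0 big_nat_cond big1 ?addn0//.
  by move=> j /andP[/andP[Gj _] _]; rewrite ltnNge Gj.
(* [m] times the sum is at most [m J + 4 N (1 - 2^-J)], multiplied by [2^J]. *)
have : m * 2 ^ J * (\sum_(j < J) \sum_(k < N) (j < G k)) + 4 * N
    <= m * J * 2 ^ J + 4 * N * 2 ^ J.
  elim: J {GJ} => [|J IH]; first by rewrite !big_ord0; lia.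
  rewrite big_ord_recr /=.
  have := @visit_count (fun k => J < G k) (m * 2 ^ J) N (fun i k => @sG J i k).
  move: IH; set S := \sum_(j < J) _; set c := \sum_(k < N) _; rewrite expnS.
  move: (2 ^ J) S c => p S c H1 H2.
  rewrite (_ : m * (2 * p) * (S + c) = 2 * (m * p * S) + 2 * (m * p * c)); last by ring.
  rewrite (_ : m * J.+1 * (2 * p) = 2 * (m * J * p) + 2 * (m * p)); last by ring.
  rewrite (_ : 4 * N * (2 * p) = 2 * (4 * N * p)); last by ring.
  lia.
set S := \sum_(j < J) _; have : 0 < 2 ^ J by rewrite expn_gt0.
move: (2 ^ J) S => p S p0 H; rewrite -(leq_pmul2r p0).
rewrite mulnDl; apply: leq_trans H.
by rewrite mulnAC leq_addr.
Qed.

Section queue.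
Variables (z G : nat -> nat).
Hypothesis zG : forall k, z k.+1 <= (z k).-1 + G k.

Lemma queue_busy N :
  \sum_(k < N) (0 < z k) + z N <= z 0 + \sum_(k < N) G k.
Proof.
elim: N => [|N IH]; first by rewrite !big_ord0 addn0.
by rewrite !big_ord_recr /=; have := zG N; case: (z N) IH => [|?] /=; lia.
Qed.

(* [s] is the last time before [n] at which the queue is empty. *)
Lemma queue_past n : z 0 = 0 -> z n = 0 \/
  exists2 s, s < n & z n + (n - s.+1) <= \sum_(s <= k < n) G k.
Proof.
move=> z0; elim: n => [|n IH]; first by left.
have [zn|zn] := posnP (z n).
  right; exists n => //; rewrite big_nat1 subnn addn0.
  by have := zG n; rewrite zn.
case: IH => [->//|[s sn H]] in zn *; right; exists s; first exact: ltnW.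
by rewrite big_nat_recr/=; [have := zG n; lia|exact: ltnW].
Qed.

(** Let l = n - s be the length of the current busy period. Its input is at most (K + l/2) + 4l/m,
    hence at most K + l as [8 <= m], while l - 1 units have been served. *)
Lemma queue_le m K n : 8 <= m -> sparse_levels m G -> z 0 = 0 ->
  (forall k, k < n -> G k <= K + (n - k)./2) -> z n <= K.+1.
Proof.
move=> m8 sG z0 GK; case: (queue_past n z0) => [->//|[s sn]].
rewrite -{2}(add0n s) big_addn big_mkord => H.
have sG' : sparse_levels m (fun k => G (k + s)).
  by move=> j i k ik Gi Gk; have := sG j _ _ _ Gi Gk; rewrite ltn_add2r subnDr; exact.
have := @sum_levels m _ (n - s) (K + (n - s)./2) sG'.
have GK' k : k < n - s -> G (k + s) <= K + (n - s)./2.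
  move=> kn; apply: leq_trans (GK _ _) _; first lia.
  by rewrite leq_add2l half_leq; lia.
move=> /(_ GK'); have := half_leq; nia.
Qed.
End queue.

End rare_visits.

(** * Derivatives on the unit interval *)

Section one_sided_derivative.
Variable R : realType.
Implicit Types (f g h : R -> R) (x y u v : R).
Local Notation I01 := (`[0, 1]%classic : set R).

Lemma within_itv_dnbhs_proper u v x : u < v -> u <= x <= v ->
  ProperFilter (within `[u, v]%classic x^').
Proof.
move=> uv /andP[ux xv]; apply: Build_ProperFilter_ex => P /nbhs_ballP[e /= e0 eP].
have [xv'|vx] := ltP x v.
  pose d := Num.min (e / 2) (v - x).
  have d0 : 0 < d by rewrite lt_min divr_gt0 ?subr_gt0.
  have [de dv] : d <= e / 2 /\ d <= v - x by rewrite !ge_min !lexx orbT.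
  exists (x + d); apply: eP => /=; last by rewrite in_itv /=; lra.
    by rewrite /ball /= opprD addNKr normrN gtr0_norm//; lra.
  by rewrite -subr_eq0 addrAC subrr add0r gt_eqF.
pose d := Num.min (e / 2) (x - u).
have ux' : u < x by apply: lt_le_trans uv vx.
have d0 : 0 < d by rewrite lt_min divr_gt0 ?subr_gt0.
have [de dv] : d <= e / 2 /\ d <= x - u by rewrite !ge_min !lexx orbT.
exists (x - d); apply: eP => /=; last by rewrite in_itv /=; lra.
  by rewrite /ball /= opprB addrC subrK gtr0_norm//; lra.
by rewrite -subr_eq0 addrAC subrr add0r oppr_eq0 gt_eqF.
Qed.

Lemma I01_dnbhs_proper x : I01 x -> ProperFilter (within I01 x^').
Proof. by rewrite /= in_itv /= => x01; apply: within_itv_dnbhs_proper. Qed.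

Lemma derive01E f x l : I01 x ->
  quotient01 f x y @[y --> within I01 x^'] --> l -> derive01 f x = l.
Proof.
move=> x01 fl; have := I01_dnbhs_proper x01 => pf.
exact/cvg_lim.
Qed.

(** Difference quotients inside [u, v] alone determine the derivative. Thus a Lipschitz bound on
    [[L0, 1]] applies even at [L0], where it says nothing about the other side. *)
Lemma derive01_le u v f x K : 0 <= u -> v <= 1 -> u < v -> u <= x <= v ->
  derivable01 f x ->
  (forall y, u <= y <= v -> `|f y - f x| <= K * `|y - x|) -> derive01 f x <= K.
Proof.
move=> u0 v1 uv xuv fx fK.
have pf := within_itv_dnbhs_proper uv xuv.
have sub : within `[u, v]%classic x^' `=>` within I01 x^'.
  move=> P; rewrite /within /=; apply: filterS => y Py.
  rewrite /= in_itv /= => /andP[uy yv]; apply: Py; rewrite /= in_itv /=.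
  by rewrite (le_trans u0 uy) (le_trans yv v1).
have cv : quotient01 f x y @[y --> within `[u, v]%classic x^'] --> derive01 f x.
  by move=> P /fx; exact: sub.
apply: (cvgr_to_le cv); rewrite near_withinE.
near=> y => /=; rewrite in_itv /= => yuv.
have yx : y != x by near: y; exact: nbhs_dnbhs_neq.
apply: le_trans (ler_norm _) _; rewrite normrM normfV ler_pdivrMr ?fK//.
by rewrite normr_gt0 subr_eq0.
Unshelve. all: by end_near. Qed.

Lemma derive01_ge0 f x : I01 x -> derivable01 f x ->
  {in I01 &, {homo f : x y / x <= y}} -> 0 <= derive01 f x.
Proof.
move=> x01 fx fhomo; have pf := I01_dnbhs_proper x01.
apply: (cvgr_to_ge fx); rewrite near_withinE.
apply: nearW => y y01; rewrite /quotient01.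
have [xy|yx] := leP x y.
  by rewrite divr_ge0 ?subr_ge0// fhomo// inE.
by rewrite -mulrNN -invrN !opprB divr_ge0 ?subr_ge0 ?(ltW yx)// fhomo// ?inE// ltW.
Qed.

Lemma derive01_comp f g h x (g' h' : R) : I01 x ->
  (forall y, I01 y -> I01 (h y)) -> (forall y, I01 y -> f y = g (h y)) ->
  quotient01 h x y @[y --> within I01 x^'] --> h' ->
  quotient01 g (h x) y @[y --> within I01 (h x)^'] --> g' ->
  quotient01 f x y @[y --> within I01 x^'] --> g' * h'.
Proof.
move=> x01 h01 fgh hx gx; have pf := I01_dnbhs_proper x01.
(* Caratheodory slope of [g] at [h x], continuous there even if [h y = h x]. *)
pose s z := if z == h x then g' else quotient01 g (h x) z.
have sg : s z @[z --> within I01 (nbhs (h x))] --> g'.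
  move=> P nP.
  have H : \forall z \near nbhs (h x), z != h x -> I01 z ->
    P (quotient01 g (h x) z) by exact: gx P nP.
  suff : \forall z \near nbhs (h x), I01 z -> P (s z) by [].
  apply: filterS H => z /= H z01; rewrite /s; case: eqP => [_|/eqP zx].
    exact: nbhs_singleton nP.
  exact: H.
have hc : h y @[y --> within I01 x^'] --> h x.
  have : quotient01 h x y * (y - x) + h x @[y --> within I01 x^'] --> h' * (x - x) + h x.
    apply: cvgD; last exact: cvg_cst.
    apply: cvgM => //; apply: cvgB; last exact: cvg_cst.
    by apply: cvg_trans (cvg_within _) _ => //; exact: nbhs_dnbhs.
  rewrite subrr mulr0 add0r; apply: cvg_trans; apply: near_eq_cvg.
  rewrite near_withinE; near=> y => _.
  have yx : y != x by near: y; exact: nbhs_dnbhs_neq.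
  by rewrite /quotient01 divfK ?subr_eq0// subrK.
have shg : s (h y) @[y --> within I01 x^'] --> g'.
  move=> P /sg H.
  have H' : \forall y \near x^', I01 y -> I01 (h y) -> P (s (h y)) by exact: hc _ H.
  suff : \forall y \near x^', I01 y -> P (s (h y)) by [].
  by apply: filterS H' => y /= H' y01; exact: H' (h01 _ y01).
have : s (h y) * quotient01 h x y @[y --> within I01 x^'] --> g' * h'.
  exact: cvgM.
apply: cvg_trans; apply: near_eq_cvg.
rewrite near_withinE; near=> y => y01.
have yx : y != x by near: y; exact: nbhs_dnbhs_neq.
rewrite /quotient01 !fgh// /s /quotient01; case: eqP => [->|/eqP hyx].
  by rewrite !subrr !mul0r mulr0.
by rewrite mulrA divfK// subr_eq0.
Unshelve. all: by end_near. Qed.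

End one_sided_derivative.

(** * Pinched skew products *)

Section pinched_skew_product.
Variables (R : realType) (D : nat) (F : torus R D * R -> torus R D * R).
Variables (rho tstar : torus R D).
Hypothesis hF : class_F_at F rho tstar.
Implicit Types (t : torus R D) (x : R) (n : nat).
Local Notation I01 := (`[0, 1]%classic : set R).

Lemma iter_skew t x n : I01 x ->
  (iter n F (t, x)).1 = t + rho *+ n /\ I01 (iter n F (t, x)).2.
Proof.
move=> x01; elim: n => [|n [IH1 IH2]]; first by rewrite addr0.
rewrite iterS [iter n F _]surjective_pairing; split.
  by rewrite (skew_rotation hF)// IH1 mulrSr addrA.
exact: (fibre_unit hF).
Qed.

Lemma fibre_iter01 t x n : I01 x -> I01 (fibre (iter n F) t x).
Proof. by move=> x01; exact: (iter_skew t n x01).2. Qed.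

Lemma fibre_iterS t x n : I01 x ->
  fibre (iter n.+1 F) t x = fibre F (t + rho *+ n) (fibre (iter n F) t x).
Proof.
move=> x01; rewrite /fibre iterS -(iter_skew t n x01).1.
by rewrite -surjective_pairing.
Qed.

Lemma fibre_iter_lipschitz (alpha : R) n t x y : 0 <= alpha ->
  (forall t (x y : R), I01 x -> I01 y ->
    `|fibre F t x - fibre F t y| <= alpha * `|x - y|) ->
  I01 x -> I01 y ->
  `|fibre (iter n F) t x - fibre (iter n F) t y| <= alpha ^+ n * `|x - y|.
Proof.
move=> a0 lip x01 y01; elim: n => [|n IH]; first by rewrite mul1r.
rewrite !fibre_iterS//; apply: le_trans (lip _ _ _ _ _) _; try exact: fibre_iter01.
by rewrite exprS -mulrA ler_wpM2l.
Qed.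

Lemma fibre_iter_zero t n : fibre (iter n F) t 0 = 0.
Proof.
have z01 : I01 (0 : R) by rewrite /= in_itv /= lexx ler01.
by elim: n => [//|n IH]; rewrite fibre_iterS// IH (zero_line hF).
Qed.

Lemma derive01_iter t x n : I01 x ->
  derive01 (fibre (iter n F) t) x =
  \prod_(k < n) derive01 (fibre F (t + rho *+ k)) (fibre (iter k F) t x).
Proof.
move=> x01; apply: derive01E => //; elim: n => [|n IH].
  rewrite big_ord0.
  have : (1 : R) @[_ --> within I01 x^'] --> (1 : R) by exact: cvg_cst.
  apply: cvg_trans; apply: near_eq_cvg.
  rewrite near_withinE; near=> y => _; rewrite /quotient01 /= divff// subr_eq0.
  by near: y; exact: nbhs_dnbhs_neq.
rewrite big_ord_recr /= mulrC.
apply: (derive01_comp (g := fibre F (t + rho *+ n)) (h := fibre (iter n F) t)) => //.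
- by move=> y y01; exact: fibre_iter01.
- by move=> y y01; exact: fibre_iterS.
- by apply: (fibre_derivable hF); exact: fibre_iter01.
Unshelve. all: by end_near. Qed.

(** The [n]-th iterate maps the fibre over [t - rho *+ n] continuously, fixing 0 and sending 1 above
    [x]; by the intermediate value theorem it attains [x], so [(t, x)] lies in every image of the
    phase space. *)
Lemma phi_plus_ge (alpha : R) t x : 0 <= alpha ->
  (forall t (x y : R), I01 x -> I01 y ->
    `|fibre F t x - fibre F t y| <= alpha * `|x - y|) ->
  I01 x -> (forall n, x <= fibre (iter n F) (t - rho *+ n) 1) ->
  x <= phi_plus F t.
Proof.
move=> a0 lip x01 xle; apply: ub_le_sup.
  by exists 1 => y [+ _]; rewrite /= in_itv /= => /andP[].
split=> // n _; pose f := fibre (iter n F) (t - rho *+ n).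
have fc : {within I01, continuous f}.
  apply/subspace_continuousP => y y01; apply/cvgrPdist_le => e e0.
  (* The added 1 keeps the Lipschitz constant invertible when [alpha] is 0. *)
  have an0 : 0 < alpha ^+ n + 1 by rewrite ltr_wpDl ?exprn_ge0.
  have yd : \forall z \near nbhs y, `|y - z| <= e / (alpha ^+ n + 1).
    have d0 : 0 < e / (alpha ^+ n + 1) by rewrite divr_gt0.
    by apply: filterS (nbhsx_ballx y _ d0) => z; rewrite /ball /= => /ltW.
  rewrite near_withinE; near=> z => z01.
  apply: le_trans (fibre_iter_lipschitz _ _ a0 lip y01 z01) _.
  apply: (@le_trans _ _ ((alpha ^+ n + 1) * `|y - z|)).
    by rewrite ler_wpM2r// lerDl.
  rewrite mulrC -ler_pdivlMr//; near: z.
  exact: yd.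
have [|c c01 fcx] := @IVT _ f 0 1 x ler01 fc.
  rewrite [f 0]fibre_iter_zero; move: x01 (xle n); rewrite /= in_itv /= => /andP[x0 _] x1.
  by rewrite ge_min x0 le_max x1 orbT.
have [c1 _] := iter_skew (t - rho *+ n) n (c01 : I01 c).
exists (t - rho *+ n, c); first by split.
by rewrite [LHS]surjective_pairing c1 subrK -[in RHS]fcx.
Unshelve. all: by end_near. Qed.

(** The derivative vanishes on the whole pinched fibre and is jointly continuous; compactness of the
    fibre makes the neighbourhood uniform in [x]. *)
Lemma derive01_near_pinched (e : R) : 0 < e ->
  \forall t \near tstar, forall x, I01 x -> derive01 (fibre F t) x < e.
Proof.
move=> e0; have /compact_near_coveringP cI := @segment_compact R 0 1.
pose P t x := I01 x -> derive01 (fibre F t) x < e.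
suff : \near tstar, I01 `<=` P tstar.
  by apply: filterS => t H x x01; exact: H.
apply: (cI _ (nbhs tstar) P) => x x01.
have fc := fibre_derive_continuous hF.
have d0 : derive01 (fibre F tstar) x = 0.
  apply: derive01E => //.
  have : (0 : R) @[_ --> within I01 x^'] --> (0 : R) by exact: cvg_cst.
  apply: cvg_trans; apply: near_eq_cvg; rewrite near_withinE; apply: nearW => y y01.
  by rewrite /quotient01 /= !(pinched hF)// subrr mul0r.
have cx : derive01 (fibre F p.1) p.2
    @[p --> within (@phase R D) (nbhs (tstar, x))] --> (0 : R).
  by rewrite -d0; move/subspace_continuousP : fc => /(_ (tstar, x)); apply.
have : \forall p \near nbhs (tstar, x), phase p -> derive01 (fibre F p.1) p.2 < e.
  exact: (cvgr_lt _ cx _ e0).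
case=> -[A B] [/= At Bx] AB; exists (B, A) => // -[y t] /= [By At'] y01.
by apply: (AB (t, y)).
Qed.

End pinched_skew_product.

(** * Depth of orbits *)

Section star_dynamics.
Variables (R : realType) (D : nat) (F : torus R D * R -> torus R D * R).
Variables (rho tstar : torus R D) (alpha beta gamma L0 c d : R) (m : nat) (a b : R).
Hypothesis hF : class_F_at F rho tstar.
Hypothesis hS : star_conditions F rho tstar alpha beta gamma L0 c d m a b.
Implicit Types (t : torus R D) (x : R) (n : nat).
Local Notation I01 := (`[0, 1]%classic : set R).
Local Notation dist t := (tdist t tstar).

Let a0 : 0 < a. Proof. exact: lt_trans ltr01 (a_gt1 hS). Qed.
Let b0 : 0 < b. Proof. by case/andP : (b_unit hS). Qed.
Let L00 : 0 < L0. Proof. by case/andP : (L0_unit hS). Qed.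

Lemma star_m_ge23 : (23 <= m)%N.
Proof.
rewrite -(ltr_nat R); apply: lt_trans (star5 hS).
by rewrite ltr_pMr ?ltr0n// ltrDl divr_gt0// (gamma_gt0 hS).
Qed.

Lemma star_a_ge24 : 24%:R <= a.
Proof.
apply: le_trans (star6 hS); apply: (@le_trans _ _ m.+1%:R).
  by rewrite ler_nat ltnS star_m_ge23.
by rewrite le1r_powR ?ler1n// ltW// (d_gt1 hS).
Qed.

(** Condition 8 keeps [tstar + rho] farther than [b] from [tstar], so condition 9 at [x = 1] reads
    min(2 L0, a) <= 1 there, and [a > 1]. Hence the point 1 has depth zero. *)
Lemma star_L0_half : 2 * L0 <= 1.
Proof.
have o01 : I01 (1 : R) by rewrite /= in_itv /= lexx ler01.
have := star9 hS (tstar + rho *+ 1) o01.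
have d1 : b < dist (tstar + rho *+ 1).
  by apply: (star8 hS); have := star_m_ge23; lia.
rewrite [X in _ * X]min_l; last first.
  by rewrite mulrAC ler_pdivlMr// mul1r; have := b0; lra.
have := fibre_unit hF (tstar + rho *+ 1) o01.
rewrite /= in_itv /= mulr1 mulr1 => /andP[_ f1] /le_trans/(_ f1).
by rewrite ge_min => /orP[//|]; rewrite leNgt (a_gt1 hS).
Qed.

Lemma level_exists : exists G : torus R D -> nat, forall t,
  (0 < dist t -> b / 2 * a ^- G t <= dist t) /\
  (forall j, (j < G t)%N -> dist t < b / 2 * a ^- j).
Proof.
suff H t : exists g : nat, (0 < dist t -> b / 2 * a ^- g <= dist t) /\
    (forall j, (j < g)%N -> dist t < b / 2 * a ^- j).
  by have [G HG] := choice H; exists G.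
(* The pinched point lies in all the balls and has no finite level; 0 is a default, the lower bound
   being claimed at positive distance only. *)
have [d0|d0] := leP (dist t) 0; first by exists 0%N; split.
have ex : exists g : nat, b / 2 * a ^- g <= dist t.
  have [g hg] : exists g : nat, b / 2 / dist t <= a ^+ g.
    exists (Num.truncn (b / 2 / dist t)).+1; apply: le_trans (ltW (truncnS_gt _)) _.
    apply: (@le_trans _ _ (2 ^ (Num.truncn (b / 2 / dist t)).+1)%:R).
      by rewrite ler_nat ltnW// ltn_expl.
    by rewrite natrX lerXn2r ?nnegrE// ?(ltW a0)//; have := star_a_ge24; lra.
  by exists g; rewrite ler_pdivrMr ?exprn_gt0// [leRHS]mulrC -ler_pdivrMr.
exists (ex_minn ex); case: ex_minnP => g hg gmin; split=> // j jg.
by rewrite ltNge; apply/negP => /gmin; rewrite leqNgt jg.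
Qed.

(** Two visits to ball [j] at times [i < k] bring [tstar + rho *+ (k - i)] within b a^-j of [tstar].
    For [j = 0] condition 8 gives k - i >= m; for [j > 0] conditions 4, 6 and 7 give k - i > (m+1)^j
    >= m 2^(j-1), whence the factor 2 in [sparse_levels]. *)
Lemma star_sparse_levels (G : torus R D -> nat) t :
  (forall t j, (j < G t)%N -> dist t < b / 2 * a ^- j) ->
  sparse_levels m (fun k => G (t + rho *+ k)).
Proof.
move=> HG j i k ik /HG di /HG dk.
have n0 : (0 < k - i)%N by rewrite subn_gt0.
have dn : dist (tstar + rho *+ (k - i)) < b * a ^- j.
  apply: le_lt_trans (tdist_triangle (t + rho *+ k) _ _) _.
  have kE : t + rho *+ k = t + rho *+ i + rho *+ (k - i).
    by rewrite -addrA -mulrnDr subnKC// ltnW.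
  by rewrite {1}kE tdistD2r tdistC; lra.
case: j => [|j] in di dk dn *.
  rewrite expn0 muln1 leqNgt; apply/negP => km.
  have /(star8 hS) : (1 <= k - i <= m.-1)%N by lia.
  by move: dn; rewrite expr0 invr1 mulr1 => /lt_trans H /H; rewrite ltxx.
have mk : (m.+1 ^ j.+1 < k - i)%N.
  rewrite -(ltr_nat R) ltNge; apply/negP => km.
  have := star4 hS n0; apply/negP; rewrite -ltNge; apply: lt_le_trans dn _.
  apply: ler_pM; rewrite ?invr_ge0 ?exprn_ge0 ?(ltW a0) ?(ltW b0)//.
    exact: star7 hS.
  rewrite powRN lef_pV2 ?posrE ?exprn_gt0 ?powR_gt0 ?ltr0n//.
  apply: (@le_trans _ _ ((m.+1 ^ j.+1)%:R `^ d)).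
    by apply: ge0_ler_powR; rewrite ?nnegrE ?ler0n ?(ltW (lt_trans ltr01 (d_gt1 hS))).
  rewrite natrX -powR_mulrn ?ler0n// powRAC powR_mulrn ?powR_ge0//.
  by rewrite lerXn2r ?nnegrE ?powR_ge0 ?(ltW a0)// (star6 hS).
have : (m * 2 ^ j <= m.+1 ^ j.+1)%N.
  rewrite expnS leq_mul//; case: (j) => // p; rewrite leq_exp2r//.
  by have := star_m_ge23; lia.
rewrite (expnS 2); lia.
Qed.

(** The two factors of condition 9 act separately on the depth: the first lowers it by one, its cap
    [2 * L0] matching the truncated predecessor at 0, and the second adds at most [g]. *)
Lemma fibre_queue_step t x (z g : nat) : I01 x ->
  2 * L0 * a ^- z <= x -> b / 2 * a ^- g <= dist t ->
  2 * L0 * a ^- (z.-1 + g) <= fibre F t x.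
Proof.
have ap := a0; have bp := b0; have L0p := L00.
move=> x01 zx gt; apply: le_trans (star9 hS t x01).
rewrite exprD invfM mulrA; apply: ler_pM.
- by rewrite mulr_ge0 ?invr_ge0 ?exprn_ge0 ?(ltW a0)//; lra.
- by rewrite invr_ge0 exprn_ge0// ltW.
- rewrite le_min; apply/andP; split.
    by rewrite ler_piMr ?invf_le1 ?exprn_gt0 ?exprn_ege1 ?(ltW (a_gt1 hS))//; lra.
  case: z zx => [|z] /= zx.
    rewrite expr0 invr1 mulr1 in zx *; have x0 : 0 <= x by lra.
    by rewrite (le_trans zx)// ler_peMl// ltW// (a_gt1 hS).
  have -> : 2 * L0 * a ^- z = a * (2 * L0 * a ^- z.+1).
    by rewrite exprS; field; rewrite expf_neq0 gt_eqF.
  by rewrite ler_pM2l.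
- rewrite le_min invf_le1 ?exprn_gt0// exprn_ege1 ?(ltW (a_gt1 hS))//=.
  by rewrite -invf_div ler_pdivlMl ?divr_gt0.
Qed.

Fixpoint queue (g : nat -> nat) (z0 k : nat) : nat :=
  if k is k'.+1 then (queue g z0 k').-1 + g k' else z0.

Lemma fibre_iter_queue (G : torus R D -> nat) t x (z0 n : nat) : I01 x ->
  (forall k, (k < n)%N ->
    b / 2 * a ^- G (t + rho *+ k) <= dist (t + rho *+ k)) ->
  2 * L0 * a ^- z0 <= x ->
  2 * L0 * a ^- queue (fun k => G (t + rho *+ k)) z0 n <= fibre (iter n F) t x.
Proof.
move=> x01 + xz0; elim: n => [//|n IH] HG.
rewrite (fibre_iterS hF)//; apply: fibre_queue_step; last exact: HG.
  exact: fibre_iter01 hF _ _ _ x01.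
by apply: IH => k kn; apply: HG; exact: ltnW.
Qed.

Let level_le (G : torus R D -> nat) t K :
  (forall t j, (j < G t)%N -> dist t < b / 2 * a ^- j) ->
  b / 2 * a ^- K <= dist t -> (G t <= K)%N.
Proof. by move=> HG tK; rewrite leqNgt; apply/negP => /HG; rewrite ltNge tK. Qed.

Let radius_gt0 K : 0 < b / 2 * a ^- K.
Proof. by rewrite mulr_gt0 ?divr_gt0 ?invr_gt0 ?exprn_gt0. Qed.

(** Start from the point 1, of depth 0, over [t - rho *+ n]. The hypothesis bounds the level at time
    [k] by K + (n - k)/2, so [queue_le] bounds the depth on arrival by K + 1 whatever [n] is, as
    [phi_plus_ge] requires. *)
Lemma phi_plus_lower t (K : nat) :
  (forall i, b / 2 * a ^- (K + i.+1./2) <= dist (t - rho *+ i.+1)) ->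
  2 * L0 * a ^- K.+1 <= phi_plus F t.
Proof.
move=> tK; have [G HG] := level_exists.
have HG1 s : 0 < dist s -> b / 2 * a ^- G s <= dist s by exact: (HG s).1.
have HG2 s j : (j < G s)%N -> dist s < b / 2 * a ^- j by exact: (HG s).2.
have ap := a0; have bp := b0; have L0p := L00; have L01 := star_L0_half.
have o01 : I01 (1 : R) by rewrite /= in_itv /= lexx ler01.
have aK1 k : a ^- k <= 1.
  by rewrite invf_le1 ?exprn_gt0// exprn_ege1// ltW// (a_gt1 hS).
apply: (phi_plus_ge hF (alpha := alpha)).
- by apply: ltW; apply: lt_trans (alpha_gt2 hS).
- exact: star1 hS.
- rewrite /= in_itv /=; apply/andP; split.
    by rewrite mulr_ge0 ?invr_ge0 ?exprn_ge0 ?(ltW ap)//; lra.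
  by apply: le_trans star_L0_half; rewrite ler_piMr//; lra.
move=> n; set s := t - rho *+ n.
have sE k : (k < n)%N -> s + rho *+ k = t - rho *+ (n - k.+1).+1.
  move=> kn; rewrite /s subnSK// -{1}(subnK (ltnW kn)) mulrnDr opprD addrA.
  by rewrite subrK.
have sd k : (k < n)%N -> b / 2 * a ^- (K + (n - k)./2) <= dist (s + rho *+ k).
  by move=> kn; rewrite sE// -(subnSK kn).
apply: le_trans (fibre_iter_queue (G := G) (z0 := 0) o01 _ _); last 2 first.
- move=> k kn; apply: HG1; exact: lt_le_trans (sd k kn).
- by rewrite expr0 invr1 mulr1.
rewrite ler_pM2l ?mulr_gt0// lef_pV2 ?posrE ?exprn_gt0// ler_eXn2l ?(a_gt1 hS)//.
apply: (@queue_le _ (fun k => G (s + rho *+ k)) _ m) => //.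
- by have := star_m_ge23; lia.
- exact: star_sparse_levels HG2.
- by move=> k kn; apply: level_le HG2 _; exact: sd.
Qed.

(** An iterate below [L0] has a nonempty queue, since an empty one forces at least [2 * L0]. Busy
    steps number at most the initial load K + 1 plus the input K + 4N/m. *)
Lemma few_low_iterates t x (K N : nat) : I01 x -> 2 * L0 * a ^- K.+1 <= x ->
  (forall k, (k < N)%N -> b / 2 * a ^- K <= dist (t + rho *+ k)) ->
  (m * (\sum_(k < N) (fibre (iter k F) t x < L0)%R) <= m * (2 * K + 1) + 4 * N)%N.
Proof.
move=> x01 xK tK; have [G HG] := level_exists.
have HG1 s : 0 < dist s -> b / 2 * a ^- G s <= dist s by exact: (HG s).1.
have HG2 s j : (j < G s)%N -> dist s < b / 2 * a ^- j by exact: (HG s).2.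
pose g k := G (t + rho *+ k).
have sg : sparse_levels m g by exact: star_sparse_levels HG2.
have gK k : (k < N)%N -> (g k <= K)%N.
  by move=> kN; apply: level_le HG2 _; exact: tK.
have := sum_levels sg gK.
have := @queue_busy (queue g K.+1) g (fun k => leqnn _) N.
have low k : (k < N)%N -> ((fibre (iter k F) t x < L0)%R <= (0 < queue g K.+1 k))%N.
  move=> kN; case: posnP => [z0|]; last by case: (_ < _).
  have : 2 * L0 * a ^- queue g K.+1 k <= fibre (iter k F) t x.
    apply: fibre_iter_queue => // j jk; apply: HG1.
    by apply: lt_le_trans (tK _ _) => //; exact: ltn_trans kN.
  by rewrite z0 expr0 invr1 mulr1; case: ltP => //; have := L00; lra.
have : (\sum_(k < N) (fibre (iter k F) t x < L0)%R
    <= \sum_(k < N) (0 < queue g K.+1 k))%N.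
  by apply: leq_sum => k _; exact: low.
rewrite [queue g K.+1 0]/=.
move: (\sum_(k < N) (_ < L0)%R)%N (\sum_(k < N) (0 < queue _ _ _))%N.
move: (\sum_(k < N) g k)%N => A B C h1 h2 h3.
have : (m * B <= m * (K.+1 + A))%N by rewrite leq_mul2l; lia.
rewrite !mulnDr; move: h3; nia.
Qed.

(** In the chain rule a factor taken below [L0] is at most [alpha], any other at most alpha^-gamma.
    With S low iterates the exponent is S - gamma (N - S). *)
Lemma derive01_iter_le t x N : I01 x ->
  derive01 (fibre (iter N F) t) x <= alpha `^
    ((1 + gamma) * (\sum_(k < N) (fibre (iter k F) t x < L0)%R)%:R - gamma * N%:R).
Proof.
move=> x01; rewrite (derive01_iter hF)//.
have al1 : 1 < alpha by apply: lt_trans (alpha_gt2 hS); rewrite ltr1n.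
have al0 : 0 < alpha by apply: lt_trans al1.
elim: N => [|N IH]; first by rewrite !big_ord0 !mulr0 subr0 powRr0.
rewrite !big_ord_recr /= natrD.
set A := (\sum_(k < N) _)%N in IH *; set y := fibre (iter N F) t x.
have y01 : I01 y by exact: fibre_iter01 hF _ _ _ x01.
set e : R := ((y < L0)%R : nat)%:R.
have -> : (1 + gamma) * (A%:R + e) - gamma * N.+1%:R =
  ((1 + gamma) * A%:R - gamma * N%:R) + ((1 + gamma) * e - gamma).
  by rewrite -natr1; ring.
rewrite powRD ?(gt_eqF al0) ?implybT//.
have d0 s z : I01 z -> 0 <= derive01 (fibre F s) z.
  move=> z01; apply: derive01_ge0 => //; first exact: (fibre_derivable hF).
  exact: fibre_nondecreasing hF _.
apply: ler_pM => //.
    by apply: prodr_ge0 => k _; apply: d0; exact: fibre_iter01 hF _ _ _ x01.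
  exact: d0.
have yd : derivable01 (fibre F (t + rho *+ N)) y by exact: (fibre_derivable hF).
move: (y01); rewrite /= in_itv /= => /andP[y0 y1].
rewrite /e; have [yL|yL] := ltP y L0.
  rewrite mulr1 addrK powRr1 ?(ltW al0)//.
  apply: (derive01_le (u := 0) (v := 1)); rewrite ?lexx ?ltr01 ?y0 ?y1//.
  by move=> z z01; apply: (star1 hS); rewrite //= in_itv.
rewrite mulr0 sub0r; have /andP[L0p L1] := L0_unit hS.
apply: (derive01_le (u := L0) (v := 1)) => //; first exact: ltW.
  by rewrite yL.
by move=> z z01; apply: (star2 hS) => //; rewrite yL.
Qed.

End star_dynamics.

(** * Exponential decay *)

Section deviation.
Variables (R : realType) (D : nat) (F : torus R D.+1 * R -> torus R D.+1 * R).
Variables (rho tstar : torus R D.+1) (alpha beta gamma L0 c d : R) (m : nat) (a b : R).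
Hypothesis hF : class_F_at F rho tstar.
Hypothesis hS : star_conditions F rho tstar alpha beta gamma L0 c d m a b.
Implicit Types (t : torus R D.+1) (x : R) (N : nat).
Local Notation I01 := (`[0, 1]%classic : set R).
Local Notation dist t := (tdist t tstar).
Local Notation bad N := (mu_phi_plus F [set p | phase p /\ (0 <= lyapunov F N p)%E]).

Lemma lyapunov_ge0_derive01 N p : (0 < N)%N -> (0 <= lyapunov F N p)%E ->
  1 <= derive01 (fibre (iter N F) p.1) p.2.
Proof.
move=> N0; rewrite /lyapunov; set y := derive01 _ _.
have Ni : 0 < N%:R^-1 :> R by rewrite invr_gt0 ltr0n.
have [y0|y0] := leP y 0.
  by rewrite le0_lneNy ?lee_fin// gt0_muleNy ?lte_fin.
have -> : lne y%:E = (ln y)%:E by rewrite /lne leNgt y0.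
rewrite -EFinM lee_fin pmulr_rge0// => ln0.
by rewrite leNgt; apply/negP => y1; move: ln0; rewrite leNgt ln_lt0// y0.
Qed.

(** Near the pinched point the first factor of the chain rule is below alpha^-N and the other N - 1
    are at most [alpha], so a box of positive measure avoids the exceptional set. *)
Lemma bad_lt1 N : (0 < N)%N -> (bad N < 1)%E.
Proof.
move=> N0; have al1 : 1 < alpha by apply: lt_trans (alpha_gt2 hS); rewrite ltr1n.
have al0 : 0 < alpha by apply: lt_trans al1.
have e0 : 0 < alpha ^- N by rewrite invr_gt0 exprn_gt0.
have [v [s [s0 v01 vU]]] := torus_nbhs_box (derive01_near_pinched hF e0).
set B := [set p | _] in vU.
have mB : measurable B by exact: measurable_tuple_box.
have B0 : (0 < lebesgue_cube R D.+1 B)%E by exact: lebesgue_cube_box_gt0.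
apply: (@le_lt_trans _ _ (lebesgue_cube R D.+1 (~` B))); last first.
  by rewrite probability_setC// lteBlDr ?lteDl ?fin_num_measure.
apply: lebesgue_cube_homo => p /= [[_ /= x01] /(lyapunov_ge0_derive01 N0) /= p1] Bp.
move: p1; apply/negP; rewrite -ltNge (derive01_iter hF)//.
set t := torus_of_tuple p in x01 *; set x := phi_plus F t in x01 *.
have d0 u z : I01 z -> 0 <= derive01 (fibre F u) z.
  move=> z01; apply: derive01_ge0 => //; first exact: (fibre_derivable hF).
  exact: fibre_nondecreasing hF _.
have da u z : I01 z -> derive01 (fibre F u) z <= alpha.
  move=> z01; apply: (derive01_le (u := 0) (v := 1)); rewrite ?lexx ?ltr01//.
    exact: (fibre_derivable hF).
  by move=> y y01; apply: (star1 hS); rewrite //= in_itv.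
case: N N0 e0 {vU} (vU) => // N _ e0 vU.
rewrite big_ord_recl /= addr0.
have xt : derive01 (fibre F t) x < alpha ^- N.+1 by exact: vU Bp x x01.
apply: (@le_lt_trans _ _ (derive01 (fibre F t) x * alpha ^+ N)).
  apply: ler_wpM2l; first exact: d0.
  rewrite -[in leRHS](card_ord N) -prodr_const; apply: ler_prod => k _.
  by rewrite d0 ?da//; exact: fibre_iter01 hF _ _ _ x01.
apply: (@lt_trans _ _ (alpha ^- N.+1 * alpha ^+ N)).
  by rewrite ltr_pM2r// exprn_gt0.
by rewrite exprS invfM mulfVK ?expf_neq0 ?gt_eqF// invf_lt1.
Qed.

(** The critical frequency of low iterates: the exponent in [derive01_iter_le] is negative exactly
    when they number less than [kappa * N]. *)
Let kappa := gamma / (1 + gamma).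

Lemma good_lyapunov_lt0 N K t : (0 < N)%N -> 4 <= kappa * N%:R ->
  K%:R <= kappa * N%:R / 4 -> I01 (phi_plus F t) ->
  (forall i, b / 2 * a ^- (K + i.+1./2) <= dist (t - rho *+ i.+1)) ->
  (forall k, (k < N)%N -> b / 2 * a ^- K <= dist (t + rho *+ k)) ->
  derive01 (fibre (iter N F) t) (phi_plus F t) < 1.
Proof.
move=> N0 kN KN x01 past future.
have g0 := gamma_gt0 hS.
have al1 : 1 < alpha by apply: lt_trans (alpha_gt2 hS); rewrite ltr1n.
have := few_low_iterates hF hS x01 (phi_plus_lower hF hS past) future.
have := derive01_iter_le hF hS t N x01.
set S := (\sum_(k < N) _)%N => le1 le2; apply: le_lt_trans le1 _.
have {}le2 : m%:R * S%:R <= m%:R * (2 * K%:R + 1) + 4 * N%:R :> R.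
  by move: le2; rewrite -(ler_nat R) natrD !natrM natrD natrM.
have m0 : 0 < m%:R :> R by rewrite ltr0n (m_gt0 hS).
have km : 22 < kappa * m%:R.
  have := star5 hS; rewrite /kappa -(ltr_pM2l (divr_gt0 g0 (addr_gt0 ltr01 g0))).
  apply: le_lt_trans; rewrite le_eqVlt; apply/orP; left; apply/eqP; field.
  by rewrite !gt_eqF// addr_gt0.
(* S <= 2K + 1 + 4N/m, where 2K <= kappa N/2, 1 <= kappa N/4 and 4N/m < (2/11) kappa N by condition
   5; the coefficients add up to less than 1. *)
have Sk : S%:R < kappa * N%:R.
  rewrite -(ltr_pM2l m0); apply: le_lt_trans le2 _.
  have NN : 22 * N%:R < kappa * m%:R * N%:R by rewrite ltr_pM2r// ltr0n.
  have : m%:R * (2 * K%:R + 1) <= m%:R * (kappa * N%:R / 2 + kappa * N%:R / 4).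
    by rewrite ler_pM2l//; lra.
  have : 0 < N%:R :> R by rewrite ltr0n.
  by move: NN; nra.
have Sg : (1 + gamma) * S%:R - gamma * N%:R < 0.
  rewrite subr_lt0 -ltr_pdivlMl ?addr_gt0//.
  by rewrite mulrA [_^-1 * _]mulrC.
rewrite /powR gt_eqF ?(lt_trans _ al1)// expR_lt1 nmulr_rlt0//.
by rewrite ln_gt0.
Qed.

Lemma bad_le N K : (0 < N)%N -> 4 <= kappa * N%:R ->
  K%:R <= kappa * N%:R / 4 -> (bad N <= (3 * a ^- K * (N%:R + 2))%:E)%E.
Proof.
move=> N0 kN KN.
have ap : 0 < a by exact: lt_trans ltr01 (a_gt1 hS).
have bp : 0 < b by case/andP : (b_unit hS).
have b1 : b < 1 by case/andP : (b_unit hS).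
have aK1 k : 0 < a ^- k <= 1.
  by rewrite invr_gt0 exprn_gt0//= invf_le1 ?exprn_gt0// exprn_ege1// ltW// (a_gt1 hS).
have [v Hv] : exists v : nat -> R, forall i r p,
    dist (torus_of_tuple p + rho *+ i) < r -> circle_ball (v i) r (thead p).
  have [v Hv] := choice (fun i => tdist_circle_ball (rho *+ i) tstar).
  by exists v => i r p; exact: Hv.
have [w Hw] : exists w : nat -> R, forall i r p,
    dist (torus_of_tuple p - rho *+ i.+1) < r -> circle_ball (w i) r (thead p).
  have [w Hw] := choice (fun i => tdist_circle_ball (- (rho *+ i.+1)) tstar).
  by exists w => i r p; exact: Hw.
(* Radius 0 gives an empty arc, so the [N] future visits fit the same countable bound as the past
   ones. *)
pose r1 i := if (i < N)%N then b / 2 * a ^- K else 0.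
pose r2 i := b / 2 * a ^- (K + i.+1./2).
have rad k : 0 <= b / 2 * a ^- k <= 1.
  have /andP[k0 k1] := aK1 k; rewrite mulr_ge0 ?(ltW k0) ?divr_ge0 ?(ltW bp)//=.
  by rewrite mulr_ile1 ?(ltW k0) ?divr_ge0 ?(ltW bp)//; lra.
pose S1 := \bigcup_i circle_ball (v i) (r1 i).
pose S2 := \bigcup_i circle_ball (w i) (r2 i).
have mS1 : measurable S1 by apply: bigcupT_measurable => i; exact: measurable_circle_ball.
have mS2 : measurable S2 by apply: bigcupT_measurable => i; exact: measurable_circle_ball.
apply: (@le_trans _ _ (lebesgue_cube R D.+1 [set p | (S1 `|` S2) (thead p)])).
  apply: lebesgue_cube_homo => p /= [[_ /= x01] /(lyapunov_ge0_derive01 N0) /= p1].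
  apply: contrapT => /not_orP[n1 n2]; move: p1; apply/negP; rewrite -ltNge.
  apply: (good_lyapunov_lt0 (K := K)) => // [i|k kN'].
    by rewrite leNgt; apply/negP => /Hw ?; apply: n2; exists i.
  rewrite leNgt; apply/negP => /Hv ?; apply: n1; exists k => //.
  by rewrite /r1 kN'.
rewrite lebesgue_cube_thead; last exact: measurableU.
have := measureU2 (uniform_prob (@ltr01 R)) mS1 mS2; move=> /le_trans; apply.
have pK : 0 < a ^- K by have /andP[] := aK1 K.
have C1 : (uniform_prob (@ltr01 R) S1 <= (3 * a ^- K * N%:R)%:E)%E.
  apply: uniform_prob_bigcup_circle_ball => [i|n].
    by rewrite /r1; case: ifP => _; rewrite ?rad// lexx ler01.
  apply: (@le_trans _ _ (3 * a ^- K * (minn n N)%:R)); last first.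
    by rewrite ler_pM2l ?mulr_gt0// ler_nat geq_minr.
  elim: n => [|n IH]; first by rewrite big_nil min0n mulr0.
  rewrite big_nat_recr//= /r1; case: ltnP => nN; last first.
    by rewrite mulr0 addr0 (minn_idPr _) ?(leq_trans nN)//; rewrite (minn_idPr nN) in IH.
  rewrite (minn_idPl nN) -(natr1 n) mulrDr; rewrite (minn_idPl (ltnW nN)) in IH.
  by rewrite lerD// mulr1 mulrA ler_pM2r//; lra.
have C2 : (uniform_prob (@ltr01 R) S2 <= (3 * a ^- K * 2)%:E)%E.
  apply: uniform_prob_bigcup_circle_ball => [i|n]; first exact: rad.
  apply: (@le_trans _ _ (3 * a ^- K * (2 - 2 * 2 ^- n))); last first.
    by rewrite ler_pM2l ?mulr_gt0// gerDl oppr_le0 mulr_ge0.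
  elim: n => [|n IH]; first by rewrite big_nil expr0 invr1 mulr1 subrr mulr0.
  rewrite big_nat_recr//= /r2 exprD invfM.
  (* The past radii shrink by [a] only every second step; [a >= 4] still yields a geometric series
     of ratio 1/2, with sum 2. *)
  have h2 : a ^- n.+1./2 <= 2 ^- n.
    rewrite lef_pV2 ?posrE ?exprn_gt0//.
    apply: (@le_trans _ _ ((2 ^+ 2) ^+ n.+1./2)).
      rewrite -exprM ler_eXn2l ?ltr1n//; lia.
    by rewrite lerXn2r ?nnegrE ?(ltW ap)//; have := star_a_ge24 hS; lra.
  have -> : 3 * a ^- K * (2 - 2 * 2 ^- n.+1) =
      3 * a ^- K * (2 - 2 * 2 ^- n) + 3 * a ^- K * 2 ^- n.
    by rewrite exprS; field; rewrite !expf_neq0// gt_eqF.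
  rewrite lerD// !mulrA; apply: ler_pM; rewrite ?invr_ge0 ?exprn_ge0 ?(ltW ap)//.
    by rewrite !mulr_ge0 ?(ltW bp) ?invr_ge0 ?exprn_ge0 ?(ltW ap).
  by rewrite ler_pM2r//; lra.
by apply: le_trans (leeD C1 C2) _; rewrite -EFinD lee_fin -mulrDr.
Qed.

Lemma bad_le_expR : exists (N1 : nat) (g : R), 0 < g /\
  forall N, (N1 <= N)%N -> (0 < N)%N -> (bad N <= (expR (- (g * N%:R)))%:E)%E.
Proof.
have ap : 1 < a by exact: a_gt1 hS.
have k0 : 0 < kappa by rewrite divr_gt0 ?addr_gt0 ?(gamma_gt0 hS).
pose eta := kappa / 4 * ln a.
have l0 : 0 < ln a by rewrite ln_gt0.
have eta0 : 0 < eta by rewrite mulr_gt0// divr_gt0.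
(* [bad_le] with K near kappa N/4 gives decay at rate [eta] times 3a(N + 2). Half the rate absorbs
   that factor: exp(eta N/2) >= (eta N/4)^2 >= 9aN >= 3a(N + 2) once N >= 144 a / eta^2. *)
exists (Num.truncn (4 / kappa + 144 * a / eta ^+ 2)).+1, (eta / 2).
split=> [|N NN N0]; first by rewrite divr_gt0.
have NR : 4 / kappa + 144 * a / eta ^+ 2 <= N%:R.
  by apply/ltW/(lt_le_trans (truncnS_gt _)); rewrite ler_nat.
have q1 : 0 < 4 / kappa by rewrite divr_gt0.
have q2 : 0 < 144 * a / eta ^+ 2.
  by rewrite divr_gt0 ?exprn_gt0// mulr_gt0// (lt_trans ltr01).
have kN : 4 <= kappa * N%:R by rewrite mulrC -ler_pdivrMr//; lra.
have eN : 144 * a <= N%:R * eta ^+ 2 by rewrite -ler_pdivrMr ?exprn_gt0//; lra.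
pose K := Num.truncn (kappa * N%:R / 4).
have /andP[K1 K2] : K%:R <= kappa * N%:R / 4 < K.+1%:R.
  by apply: truncn_itv; rewrite divr_ge0// mulr_ge0// ltW.
apply: le_trans (bad_le N0 kN K1) _; rewrite lee_fin.
have aK : a ^- K <= a * expR (- (eta * N%:R)).
  have ap0 : 0 < a by exact: lt_trans ap.
  rewrite -ler_pdivrMl// -invfM -exprS expRN.
  rewrite lef_pV2 ?posrE ?expR_gt0 ?exprn_gt0//.
  have -> : a ^+ K.+1 = expR (K.+1%:R * ln a).
    by rewrite expRM_natl lnK// posrE (lt_trans ltr01).
  rewrite ler_expR /eta mulrAC ler_pM2r ?ln_gt0//; lra.
have N1 : 1 <= N%:R :> R by rewrite ler1n.
have ex : 3 * a * (N%:R + 2) <= expR (eta / 2 * N%:R).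
  have -> : eta / 2 * N%:R = eta / 4 * N%:R + eta / 4 * N%:R by field.
  rewrite expRD; apply: (@le_trans _ _ ((eta / 4 * N%:R) * (eta / 4 * N%:R))).
    nra.
  have e0 : 0 <= eta / 4 * N%:R by rewrite mulr_ge0// divr_ge0// ltW.
  have e1 : eta / 4 * N%:R <= expR (eta / 4 * N%:R).
    by apply: le_trans (expR_ge1Dx _); lra.
  by apply: ler_pM.
apply: (@le_trans _ _ (3 * (a * expR (- (eta * N%:R))) * (N%:R + 2))).
  by rewrite ler_pM2r ?ler_pM2l//; lra.
rewrite (_ : - (eta * N%:R) = - (eta / 2 * N%:R) - eta / 2 * N%:R); last by field.
rewrite expRD (_ : _ * _ * _ = expR (- (eta / 2 * N%:R)) *
  (3 * a * (N%:R + 2) / expR (eta / 2 * N%:R))); last by rewrite expRN; ring.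
by rewrite ler_piMr ?expR_ge0// ler_pdivrMr ?expR_gt0// mul1r.
Qed.

End deviation.

(** The threshold [n] is lowered one step at a time, shrinking the rate so that it also covers
    [u n < 1]. *)
Lemma eventually_expR_bound (R : realType) (u : nat -> \bar R) (n : nat) (g : R) :
  0 < g -> (forall N, (0 < N)%N -> u N < 1)%E ->
  (forall N, (n <= N)%N -> (0 < N)%N -> (u N <= (expR (- (g * N%:R)))%:E)%E) ->
  exists g' : R, 0 < g' /\
    forall N, (0 < N)%N -> (u N <= (expR (- (g' * N%:R)))%:E)%E.
Proof.
move=> g0 u1; elim: n g g0 => [|n IH] g g0 ug; first by exists g; split=> // N; exact: ug.
have [n0|n0] := posnP n.
  by exists g; split=> // N N0; apply: ug => //; rewrite n0.
have [h h0 uh] : exists2 h : R, 0 < h & (u n <= (expR (- (h * n%:R)))%:E)%E.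
  have [r r1 ur] : exists2 r : R, 0 < r < 1 & (u n <= r%:E)%E.
    (* The value 1/2 keeps the argument of the logarithm positive when [u n] is not. *)
    have := u1 n n0; case: (u n) => [r|//|_]; last by exists 2^-1; rewrite ?leNye//; lra.
    rewrite lte_fin => r1; exists (Num.max r 2^-1); last by rewrite lee_fin le_max lexx.
    by rewrite lt_max gt_max r1; lra.
  have /andP[r0 r1'] := r1; have nR : 0 < n%:R :> R by rewrite ltr0n.
  exists (- ln r / n%:R); first by rewrite divr_gt0// oppr_gt0 ln_lt0.
  by rewrite divfK ?gt_eqF// opprK lnK.
apply: (IH (Num.min g h)) => [|N nN N0]; first by rewrite lt_min g0.
have le k : Num.min g h <= k -> expR (- (k * N%:R)) <= expR (- (Num.min g h * N%:R)).
  by move=> mk; rewrite ler_expR lerN2 ler_wpM2r.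
move: nN; rewrite leq_eqVlt => /orP[/eqP nN|nN].
  by rewrite -nN in le *; apply: le_trans uh _; rewrite lee_fin le// ge_min lexx orbT.
by apply: le_trans (ug N nN N0) _; rewrite lee_fin le// ge_min lexx.
Qed.

Theorem theorem4p8 (R : realType) (D : nat) (hD : (0 < D)%N)
    (F : torus R D * R -> torus R D * R) (hF : class_Fstar F) :
  exists gamma_minus : R, 0 < gamma_minus /\
    forall N : nat, (0 < N)%N ->
      (mu_phi_plus F [set p | phase p /\ 0 <= lyapunov F N p]
        <= (expR (- (gamma_minus * N%:R)))%:E)%E.
Proof.
case: D hD F hF => // D _ F.
move=> [rho [tstar [hF [alpha [beta [gamma [L0 [c [d [m [a [b hS]]]]]]]]]]]].
have [n [g [g0 Hg]]] := bad_le_expR hF hS.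
apply: eventually_expR_bound g0 _ Hg => N N0.
exact: bad_lt1 hF hS _ N0.
Qed.
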